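(* Let assumptions A1, A2, A3 (stated in the context) hold and let $\theta_k \in (0,2)$. Let $x_{k+1}^\delta$ be obtained from $x_k^\delta$ by one step of the PLWK iteration described in the context. If $x_k^\delta \in B_\rho(x_0)$ and $\|F_{[k]}(x_k^\delta) - y_{[k]}^\delta\| > \tau \delta_{[k]}$, then $$\|x^\star - x_k^\delta\|^2 \ \ge\ \|x^\star - x_{k+1}^\delta\|^2 + \theta_k(2-\theta_k) \left( \frac{p_{[k]}\big(\|F_{[k]}(x_k^\delta) - y_{[k]}^\delta\|\big)}{\big\|F_{[k]}'(x_k^\delta)^*\big(F_{[k]}(x_k^\delta) - y_{[k]}^\delta\big)\big\|} \right)^2$$ for all $x^\star \in B_\rho(x_0)$ with $F_{[k]}(x^\star) = y_{[k]}$ and, in particular, for all $x^\star$ as in A3.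
   Context: $X$ and $Y$ are real Hilbert spaces, $N \ge 1$ is an integer, and $F_i : D(F_i) \subset X \to Y$, $i = 0,\dots,N-1$, are (in general nonlinear) operators. $B_r(x)$ denotes the open ball of radius $r$ centred at $x$ in $X$. Exact data $y_0,\dots,y_{N-1} \in Y$, noisy data $y_0^\delta,\dots,y_{N-1}^\delta \in Y$ and noise levels $\delta_0,\dots,\delta_{N-1}\ge 0$ (with $\delta_i = 0$ meaning exact data) satisfy $\|y_i^\delta - y_i\| \le \delta_i$ for all $i$. Assumption A1: each $F_i$ is continuous on $D(F_i)$; $D := \bigcap_{i} D(F_i)$ has nonempty interior; the initial iterate $x_0 \in D$ is given and there exist constants $C, \rho > 0$ such that $B_\rho(x_0) \subset D$, the Gateaux derivative $F_i'$ is defined on $B_\rho(x_0)$ (with each $F_i'(x): X \to Y$ bounded linear), and $\|F_i'(x)\| \le C$ for all $x \in B_\rho(x_0)$ and $i = 0,\dots,N-1$. Assumption A2 (tangential cone condition): there is a constant $0 \le \eta < 1$ such that $\|F_i(\bar x) - F_i(x) - F_i'(x)(\bar x - x)\| \le \eta\, \|F_i(\bar x) - F_i(x)\|$ for all $x, \bar x \in B_\rho(x_0)$ and $i = 0,\dots,N-1$. Assumption A3: there exists $x^\star \in B_{\rho/2}(x_0)$ with $F_i(x^\star) = y_i$ for $i = 0,\dots,N-1$. PLWK iteration: write $[k] := k \bmod N \in \{0,\dots,N-1\}$. Fix $\tau > (1+\eta)(1-\eta)^{-1}$ with $\tau>1$, and set $p_i(t) := t\big((1-\eta)t - (1+\eta)\delta_i\big)$.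 Starting from $x_0^\delta = x_0$, $$x_{k+1}^\delta := x_k^\delta - \theta_k \lambda_k \omega_k F_{[k]}'(x_k^\delta)^*\big(F_{[k]}(x_k^\delta) - y_{[k]}^\delta\big),$$ where $\theta_k \in (0,2)$ is a relaxation parameter, $\omega_k := 1$ if $\|F_{[k]}(x_k^\delta) - y_{[k]}^\delta\| > \tau\delta_{[k]}$ and $\omega_k := 0$ otherwise, and $$\lambda_k := \frac{p_{[k]}\big(\|F_{[k]}(x_k^\delta) - y_{[k]}^\delta\|\big)}{\big\|F_{[k]}'(x_k^\delta)^*\big(F_{[k]}(x_k^\delta) - y_{[k]}^\delta\big)\big\|^2}$$ if $F_{[k]}'(x_k^\delta)^*(F_{[k]}(x_k^\delta) - y_{[k]}^\delta) \ne 0$, and $\lambda_k := 0$ otherwise. (Here $F_i'(x)^*$ is the Hilbert space adjoint.) *)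

(* Defs.v *)
From HB Require Import structures.
From mathcomp Require Import all_boot all_order all_algebra.
From mathcomp Require Import all_classical all_reals all_analysis.

Set Implicit Arguments.
Unset Strict Implicit.
Unset Printing Implicit Defensive.

Import Order.TTheory GRing.Theory Num.Theory.
Import numFieldNormedType.Exports.

Local Open Scope classical_set_scope.
Local Open Scope ring_scope.

HB.mixin Record CompleteNormedModule_isHilbert (R : realType) V
    of CompleteNormedModule R V := {
  inner : {dot V for (@idfun R)} ;
  inner_normE : forall x : V, inner x x = `|x| ^+ 2
}.

#[short(type="hilbertType")]
HB.structure Definition Hilbert (R : realType) :=
  {V of CompleteNormedModule R V & CompleteNormedModule_isHilbert R V}.

Section Operators.
Variables (R : realType) (X Y : hilbertType R).

Definition bounded_linear (T : X -> Y) : Prop :=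
  linear T /\ exists M : R, forall v, `|T v| <= M * `|v|.

(* Only meaningful for bounded T: [sup] of an unbounded set is 0. *)
Definition opnorm (T : X -> Y) : R := sup [set `|T v| | v in [set v | `|v| <= 1]].

(* For bounded linear T the defining vector exists (Riesz) and is unique. *)
Definition adjoint (T : X -> Y) (y : Y) : X :=
  get (fun z : X => forall v, inner (T v) y = inner v z).

(* The operator v |-> f'(x) v. It only depends on f near x, hence it is also the
   right notion for an f that is relevant only on a neighbourhood of x. *)
Definition gateaux (f : X -> Y) (x : X) : X -> Y := fun v => 'D_v f x.

Definition gateaux_differentiable (f : X -> Y) (x : X) : Prop :=
  (forall v, derivable f x v) /\ bounded_linear (gateaux f x).

End Operators.

Section Assumptions.
Variables (R : realType) (X Y : hilbertType R) (N : nat).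
(* The partial operator F_i : D(F_i) -> Y is given by a set [D i] and a function
   [F i] whose values outside [D i] are irrelevant. *)
Variables (D : 'I_N -> set X) (F : 'I_N -> X -> Y) (y : 'I_N -> Y).
Variables (x0 : X) (rho : R).

Definition assumption_A1 (C : R) : Prop :=
  [/\ forall i, {within D i, continuous (F i)},
      (\bigcap_i D i)° !=set0,
      (\bigcap_i D i) x0,
      0 < C /\ 0 < rho
    & ball x0 rho `<=` \bigcap_i D i /\
      forall i x, ball x0 rho x ->
        gateaux_differentiable (F i) x /\ opnorm (gateaux (F i) x) <= C].

Definition assumption_A2 (eta : R) : Prop :=
  0 <= eta < 1 /\
  forall i x xbar, ball x0 rho x -> ball x0 rho xbar ->
    `|F i xbar - F i x - gateaux (F i) x (xbar - x)| <= eta * `|F i xbar - F i x|.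

Definition A3_solution (xstar : X) : Prop :=
  ball x0 (rho / 2) xstar /\ forall i, F i xstar = y i.

Definition assumption_A3 : Prop := exists xstar, A3_solution xstar.

End Assumptions.

Definition cyc (N : nat) (N_gt0 : (0 < N)%N) (k : nat) : 'I_N :=
  Ordinal (ltn_pmod k N_gt0).

Section PLWK.
Variables (R : realType) (X Y : hilbertType R) (N : nat) (N_gt0 : (0 < N)%N).
Variables (F : 'I_N -> X -> Y) (ydelta : 'I_N -> Y) (delta : 'I_N -> R).
Variables (eta tau : R) (theta : nat -> R).

Local Notation "[ k ]_N" := (cyc N_gt0 k) (format "[ k ]_N").

Definition plwk_p (i : 'I_N) (t : R) : R :=
  t * ((1 - eta) * t - (1 + eta) * delta i).

Definition plwk_residual (k : nat) (x : X) : Y := F [k]_N x - ydelta [k]_N.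

Definition plwk_direction (k : nat) (x : X) : X :=
  adjoint (gateaux (F [k]_N) x) (plwk_residual k x).

Definition plwk_omega (k : nat) (x : X) : R :=
  if tau * delta [k]_N < `|plwk_residual k x| then 1 else 0.

Definition plwk_lambda (k : nat) (x : X) : R :=
  if plwk_direction k x != 0 then
    plwk_p [k]_N `|plwk_residual k x| / `|plwk_direction k x| ^+ 2
  else 0.

Definition plwk_step (k : nat) (x : X) : X :=
  x - (theta k * plwk_lambda k x * plwk_omega k x) *: plwk_direction k x.

End PLWK.

(* Main.v *)
Require Import Defs.
From mathcomp Require Import all_boot all_order all_algebra.
From mathcomp Require Import all_classical all_reals all_analysis.
From mathcomp Require Import ring lra.

Import Order.TTheory GRing.Theory Num.Theory.
Import numFieldNormedType.Exports.

Local Open Scope classical_set_scope.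
Local Open Scope ring_scope.

(** Write [T] for the derivative at the current iterate [xk], [r] for the
    residual, [e = xk - xstar] for the error and [d = T^* r] for the direction.
    Since [F xstar - ydelta] has norm at most [delta], the tangential cone
    condition says that [T e] equals [r] up to an error of norm at most
    [eta (|r| + delta) + delta].  Taking the inner product with [r] gives
      [<e, d> = <T e, r> >= |r| ((1 - eta) |r| - (1 + eta) delta) = p(|r|)]
    ([tangential_cone_inner_ge]).  Geometrically, [xstar] lies beyond the
    hyperplane [{z | <xk - z, d> = p}] as seen from [xk], and for [theta = 1]
    the step is the orthogonal projection onto that hyperplane.  Expanding
    [|e - theta (p / |d|^2) d|^2] then yields the stated gain
    ([relaxed_step_descent]); the discrepancy inequality and the lower bound on
    [tau] ensure that [p] is nonnegative.

    The identity [<T e, r> = <e, T^* r>] requires the adjoint to exist, which is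
    the Riesz representation theorem ([riesz_representation], [adjointE]).  It
    is obtained by minimising [|v|^2 - 2 f v]: a point whose value is within
    [eps^2] of the infimum represents [f] up to [eps], approximate representers
    are close to one another, and completeness supplies the exact one. *)

Section InnerProduct.
Variables (R : realType) (V : hilbertType R).
Implicit Types u v w : V.

Lemma innerC u v : inner u v = inner v u.
Proof. by rewrite hermC expr0 mul1r. Qed.

Lemma sqr_normD u v : `|u + v| ^+ 2 = `|u| ^+ 2 + 2 * inner u v + `|v| ^+ 2.
Proof.
rewrite -!inner_normE linearDl !linearDr /= (innerC v u); ring.
Qed.

(** The norm is known to be subadditive, so the inequality can be read off from
    [|u + v|^2 <= (|u| + |v|)^2] by expanding both sides. *)
Lemma cauchy_schwarz u v : `|inner u v| <= `|u| * `|v|.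
Proof.
wlog inner_ge0 : u / 0 <= inner u v => [wlog_ge0|].
  have [/wlog_ge0//|/ltW inner_le0] := leP 0 (inner u v).
  by have := wlog_ge0 (- u); rewrite linearNl !normrN oppr_ge0; apply.
rewrite ger0_norm //.
have : `|u + v| ^+ 2 <= (`|u| + `|v|) ^+ 2.
  by rewrite lerXn2r ?nnegrE ?addr_ge0 ?ler_normD.
rewrite sqr_normD; nra.
Qed.

End InnerProduct.

Section Riesz.
Variables (R : realType) (V : hilbertType R) (f : V -> R) (M : R).
Hypothesis f_scalar : scalar f.
Hypothesis f_bounded : forall v, `|f v| <= M * `|v|.

(** A near-minimiser [u] of [J v = |v|^2 - 2 f v] almost satisfies the Euler
    equation: along the line [u + t h], [J] is a quadratic in [t] that cannot
    drop by more than [eps^2] below [J u], which bounds its slope at [t = 0]. *)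
Lemma almost_representer (eps : R) : 0 < eps ->
  exists u : V, forall h, `|inner h u - f h| <= eps * `|h|.
Proof.
move=> eps_gt0.
pose J (v : V) := `|v| ^+ 2 - 2 * f v.
have has_lbJ : has_lbound (range J).
  (* [J v >= |v|^2 - 2 M |v| = (|v| - M)^2 - M^2] *)
  exists (- M ^+ 2) => _ [v _ <-]; rewrite /J.
  have := f_bounded v; have := ler_norm (f v).
  have := sqr_ge0 (`|v| - M); nra.
have has_infJ : has_inf (range J) by split=> //; exists (J 0); exists 0.
have eps2_gt0 : 0 < eps ^+ 2 by rewrite exprn_gt0.
have [_ [u _ <-] Ju_lt] := inf_adherent eps2_gt0 has_infJ.
exists u => h.
have [->|h_neq0] := eqVneq h 0.
  have f0 : f 0 = 0.
    apply/eqP; rewrite -normr_le0 (le_trans (f_bounded 0)) //.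
    by rewrite normr0 mulr0.
  by rewrite f0 linear0l subrr !normr0 mulr0.
have h_gt0 : 0 < `|h| by rewrite normr_gt0.
have J_line t :
    J (t *: h + u) = J u + 2 * t * (inner h u - f h) + t ^+ 2 * `|h| ^+ 2.
  rewrite /J sqr_normD f_scalar linearZl_LR normrZ exprMn real_normK ?num_real //=; ring.
set g := inner h u - f h in J_line *.
(* [t = - g / |h|^2] minimises the quadratic of [J_line]. *)
have : inf (range J) <= J (- (g / `|h| ^+ 2) *: h + u).
  by apply: ge_inf => //; exists (- (g / `|h| ^+ 2) *: h + u).
rewrite J_line => le_line.
have : g ^+ 2 / `|h| ^+ 2 <= eps ^+ 2.
  have -> : g ^+ 2 / `|h| ^+ 2 =
    - (2 * - (g / `|h| ^+ 2) * g + (- (g / `|h| ^+ 2)) ^+ 2 * `|h| ^+ 2).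
    by field; rewrite gt_eqF.
  lra.
rewrite ler_pdivrMr ?exprn_gt0 // -exprMn -real_normK ?num_real //.
by rewrite ler_pXn2r ?nnegrE ?mulr_ge0 // ltW.
Qed.

(** Test both representers against their own difference. *)
Lemma almost_representer_dist (eps eps' : R) (u u' : V) :
  0 <= eps -> 0 <= eps' ->
  (forall h, `|inner h u - f h| <= eps * `|h|) ->
  (forall h, `|inner h u' - f h| <= eps' * `|h|) ->
  `|u - u'| <= eps + eps'.
Proof.
move=> eps_ge0 eps'_ge0 /(_ (u - u')) repr /(_ (u - u')) repr'.
have [->|u_neq] := eqVneq u u'; first by rewrite subrr normr0 addr_ge0.
have dist_gt0 : 0 < `|u - u'| by rewrite normr_gt0 subr_eq0.
rewrite -(ler_pM2r dist_gt0) -expr2 -inner_normE linearBr mulrDl.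
rewrite -(subrKA (f (u - u'))).
apply: le_trans (ler_norm _) _; apply: le_trans (ler_normD _ _) _.
by rewrite lerD // distrC.
Qed.

(** Representers with errors tending to [0] form a Cauchy sequence, and its limit
    represents [f] exactly. *)
Theorem riesz_representation : exists z : V, forall v, f v = inner v z.
Proof.
have [u u_repr] := choice (fun n => almost_representer _ (harmonic_gt0 n)).
have harmonic_small (e : R) : 0 < e -> \forall n \near \oo, harmonic n < e.
  move=> e_gt0; near=> n.
  by near: n; apply: cvgr_lt e_gt0; exact: cvg_harmonic.
have u_cvg : cvgn u.
  apply/cauchy_cvgP/cauchy_exP => e e_gt0.
  have e2_gt0 : 0 < e / 2 by rewrite divr_gt0.
  have [N _ harmonicN] := harmonic_small _ e2_gt0.
  exists (u N), N => // n /= le_Nn.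
  rewrite -ball_normE /=.
  apply: le_lt_trans (almost_representer_dist _ _ _ _ _ _ (u_repr N) (u_repr n)) _;
    rewrite ?harmonic_ge0 //.
  by rewrite [e]splitr ltrD //; apply: harmonicN => /=.
exists (limn u) => h; apply/eqP; rewrite eq_sym -subr_eq0 -normr_le0.
apply/ler_addgt0Pl => e e_gt0; rewrite addr0.
(* Both error terms below are bounded by [e' |h|]; adding [1] to [|h|] keeps the
   denominator positive when [h = 0]. *)
pose e' := e / (2 * (`|h| + 1)).
have e'_gt0 : 0 < e' by rewrite divr_gt0 // mulr_gt0 // ltr_wpDl.
near \oo => n.
have harmonic_lt : harmonic n < e' by near: n; exact: harmonic_small.
have u_near : `|limn u - u n| < e' by near: n; exact: cvgr_dist_lt u_cvg _ e'_gt0.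
rewrite -(subrKA (inner h (u n))) -linearBr.
apply: le_trans (ler_normD _ _) _.
have -> : e = e' * (`|h| + 1) + e' * (`|h| + 1).
  by rewrite /e'; field; rewrite gt_eqF // ltr_wpDl.
have := u_repr n h; have := cauchy_schwarz _ _ h (limn u - u n).
have := normr_ge0 h.
nra.
Unshelve. all: by end_near. Qed.
End Riesz.

Section Adjoint.
Variables (R : realType) (X Y : hilbertType R) (T : X -> Y).

(** [adjoint T y] is a chosen element, so its defining property holds as soon as
    some element has it: the representer of [v |-> inner (T v) y]. *)
Lemma adjointE : bounded_linear T ->
  forall v y, inner (T v) y = inner v (adjoint T y).
Proof.
move=> [T_linear [M T_bounded]] v y; move: v.
have [||z z_repr] := @riesz_representation _ X (fun v => inner (T v) y) (M * `|y|).
- by move=> a u v; rewrite T_linear linearDl linearZl_LR.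
- move=> v; apply: le_trans (cauchy_schwarz _ _ _ _) _.
  by rewrite mulrAC ler_wpM2r.
rewrite /adjoint; case: xgetP => [z' _ //|/(_ z)]; exact.
Qed.
End Adjoint.

(** Here [Fx], [Fxs] are the values of the operator at the iterate and at a
    solution, and [Te] is the derivative applied to the error.  The cone
    condition bounds [r - Te], where [r = Fx - yd], and Cauchy-Schwarz turns
    this into a lower bound for [<Te, r> = |r|^2 - <r - Te, r>]. *)
Lemma tangential_cone_inner_ge (R : realType) (Y : hilbertType R)
    (Fx Fxs Te y yd : Y) (eta delta : R) :
  0 <= eta -> Fxs = y -> `|yd - y| <= delta ->
  `|Fx - Fxs - Te| <= eta * `|Fx - Fxs| ->
  `|Fx - yd| * ((1 - eta) * `|Fx - yd| - (1 + eta) * delta) <= inner Te (Fx - yd).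
Proof.
move=> eta_ge0 -> noise cone; set r := Fx - yd.
have dist_y : `|Fx - y| <= `|r| + delta.
  by rewrite -(subrKA yd); apply: le_trans (ler_normD _ _) _; rewrite lerD2l.
have defect : `|r - Te| <= eta * (`|r| + delta) + delta.
  have -> : r - Te = (Fx - y - Te) + (y - yd).
    by rewrite [RHS]addrAC subrKA.
  apply: le_trans (ler_normD _ _) _; rewrite [`|y - yd|]distrC lerD //.
  exact: le_trans cone (ler_wpM2l eta_ge0 dist_y).
have -> : inner Te r = `|r| ^+ 2 - inner (r - Te) r.
  by rewrite linearBl /= inner_normE subKr.
have := le_trans (ler_norm _) (cauchy_schwarz _ _ (r - Te) r).
have := normr_ge0 r; nra.
Qed.

(** The deficit between the two sides is exactly
    [2 theta (p / |d|^2) (<e, d> - p)] when [d] is nonzero.  When [d = 0] the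
    step is trivial and the gain vanishes, by the convention [p / 0 = 0]. *)
Lemma relaxed_step_descent (R : realType) (X : hilbertType R) (e d : X) (p theta : R) :
  0 <= p -> 0 <= theta -> p <= inner e d ->
  `|e - (theta * (if d != 0 then p / `|d| ^+ 2 else 0)) *: d| ^+ 2 +
    theta * (2 - theta) * (p / `|d|) ^+ 2 <= `|e| ^+ 2.
Proof.
move=> p_ge0 theta_ge0 p_le.
have [->|d_neq0] := eqVneq d 0.
  by rewrite scaler0 subr0 normr0 invr0 mulr0 expr0n mulr0 addr0.
have d_gt0 : 0 < `|d| by rewrite normr_gt0.
rewrite -scaleNr sqr_normD linearZr_LR normrZ exprMn real_normK ?num_real //=.
set c := theta * _.
have -> : `|e| ^+ 2 + 2 * (- c * inner e d) + (- c) ^+ 2 * `|d| ^+ 2 +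
    theta * (2 - theta) * (p / `|d|) ^+ 2 =
    `|e| ^+ 2 - 2 * c * (inner e d - p).
  by rewrite /c; field; rewrite gt_eqF.
rewrite gerBl mulr_ge0 ?subr_ge0 // /c !mulr_ge0 // invr_ge0 exprn_ge0 // ltW.
Qed.

Theorem proposition3p4 (R : realType) (X Y : hilbertType R)
  (N : nat) (N_gt0 : (0 < N)%N)
  (D : 'I_N -> set X) (F : 'I_N -> X -> Y)
  (y ydelta : 'I_N -> Y) (delta : 'I_N -> R)
  (delta_ge0 : forall i, 0 <= delta i)
  (noise : forall i, `|ydelta i - y i| <= delta i)
  (x0 : X) (C rho eta tau : R) (theta : nat -> R)
  (A1 : assumption_A1 D F x0 rho C)
  (A2 : assumption_A2 F x0 rho eta)
  (A3 : assumption_A3 F y x0 rho)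
  (tau_gt : (1 + eta) * (1 - eta)^-1 < tau) (tau_gt1 : 1 < tau)
  (theta_in : forall k, 0 < theta k < 2)
  (k : nat) (xk xk1 : X)
  (step : xk1 = plwk_step N_gt0 F ydelta delta eta tau theta k xk)
  (xk_in : ball x0 rho xk)
  (discrepancy : tau * delta (cyc N_gt0 k) <
     `|F (cyc N_gt0 k) xk - ydelta (cyc N_gt0 k)|) :
  let descent (xstar : X) :=
    `|xstar - xk| ^+ 2 >=
      `|xstar - xk1| ^+ 2 +
      theta k * (2 - theta k) *
      (plwk_p delta eta (cyc N_gt0 k)
          `|F (cyc N_gt0 k) xk - ydelta (cyc N_gt0 k)| /
       `|adjoint (gateaux (F (cyc N_gt0 k)) xk)
          (F (cyc N_gt0 k) xk - ydelta (cyc N_gt0 k))|) ^+ 2 in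
  (forall xstar : X, ball x0 rho xstar ->
     F (cyc N_gt0 k) xstar = y (cyc N_gt0 k) -> descent xstar) /\
  (forall xstar : X, A3_solution F y x0 rho xstar -> descent xstar).
Proof.
move=> descent; have [/andP[eta_ge0 eta_lt1] cone] := A2.
have [_ _ _ [_ rho_gt0] [_ diff]] := A1.
have theta_ge0 : 0 <= theta k by have /andP[/ltW] := theta_in k.
have main xs : ball x0 rho xs -> F (cyc N_gt0 k) xs = y (cyc N_gt0 k) -> descent xs.
  move=> xs_in xs_sol; rewrite /descent {descent} step /plwk_step.
  rewrite /plwk_lambda /plwk_direction /plwk_omega /plwk_residual discrepancy mulr1.
  have [[_ T_bl] _] := diff (cyc N_gt0 k) _ xk_in.
  have := cone (cyc N_gt0 k) _ _ xk_in xs_in.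
  set i := cyc N_gt0 k in discrepancy xs_sol T_bl *.
  set T := gateaux (F i) xk in T_bl *; set r := F i xk - ydelta i in discrepancy *.
  move=> cone_xs.
  have TN v : T (- v) = - T v.
    have [T_lin _] := T_bl.
    have T0 : T 0 = 0 by have := T_lin (-1) 0 0; rewrite scaler0 addr0 scaleN1r addNr.
    by have := T_lin (-1) v 0; rewrite !addr0 T0 addr0 !scaleN1r.
  set e := xk - xs.
  (* The cone condition is applied to [xs - xk = - e]. *)
  have p_le : plwk_p delta eta i `|r| <= inner e (adjoint T r).
    rewrite -adjointE //.
    apply: (tangential_cone_inner_ge _ _ _ (F i xs) _ _ _ _ _ eta_ge0 xs_sol
      (noise i)).
    have <- : - (F i xs - F i xk - T (xs - xk)) = F i xk - F i xs - T e.
      by rewrite -(opprB xk xs) TN opprK opprD opprB.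
    by rewrite normrN (distrC (F i xk)).
  have p_ge0 : 0 <= plwk_p delta eta i `|r|.
    (* [(1 + eta) delta <= tau (1 - eta) delta <= (1 - eta) |r|] *)
    rewrite mulr_ge0 // subr_ge0; move: tau_gt; rewrite ltr_pdivrMr ?subr_gt0 //.
    move: discrepancy (delta_ge0 i); nra.
  rewrite -normrN opprB (distrC xs) addrAC; exact: relaxed_step_descent.
split=> // xs [xs_in xs_sol]; apply: main => //.
by apply: le_ball xs_in; lra.
Qed.
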